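(* (i) There exists no string $\mathbf{a}$ of positive integers of length $3$ with a nontrivial symmetry. (ii) For each $n\ge 4$ there exists an infinite family of strings $\mathbf{a}$ of positive integers of length $n$, depending on $\lfloor (n-2)/2\rfloor$ free positive integer parameters (i.e., an injective map from $\mathbb{N}^{\lfloor (n-2)/2\rfloor}$ into $\mathbb{N}^n$), each of which has a nontrivial symmetry.
   Context: Every $x\in[0,1)$ has a continued fraction expansion $x=[0;a_1(x),a_2(x),\dots]$ with positive integer digits $a_i(x)$ (unique for irrational $x$; for rational $x$ made unique by requiring the last digit to exceed $1$). For a string $\mathbf{a}=(a_1,\dots,a_n)$ of positive integers let $I(\mathbf{a})=\{x\in[0,1): a_i(x)=a_i,\ i=1,\dots,n\}$ and $P_{GK}(\mathbf{a})=\frac{1}{\log 2}\int_{I(\mathbf{a})}\frac{dx}{1+x}$ (the Gauss--Kuzmin measure of $I(\mathbf{a})$). The reverse of $\mathbf{a}$ is $\overleftarrow{\mathbf{a}}=(a_n,\dots,a_1)$. For a permutation $\sigma$ of $\{1,\dots,n\}$, $\sigma(\mathbf{a})=(a_{\sigma(1)},\dots,a_{\sigma(n)})$. The string $\mathbf{a}$ has a nontrivial symmetry if there is a permutation $\sigma$ with $\sigma(\mathbf{a})\neq\mathbf{a}$ and $\sigma(\mathbf{a})\neq\overleftarrow{\mathbf{a}}$ such that $P_{GK}(\sigma(\mathbf{a}))=P_{GK}(\mathbf{a})$. *)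

(* Defs.v *)
From mathcomp Require Import all_boot all_order all_algebra all_fingroup.
From mathcomp Require Import all_classical all_reals all_analysis.

Set Implicit Arguments.
Unset Strict Implicit.
Unset Printing Implicit Defensive.

Import Order.TTheory GRing.Theory Num.Theory.
Import numFieldNormedType.Exports.

Local Open Scope classical_set_scope.
Local Open Scope ring_scope.

(* Indices are shifted throughout: a string (a_1, ..., a_n) is an n.-tuple
   whose entry number i is a_(i+1). *)

Definition positive_digits : pred (seq nat) := fun s => all (leq 1) s.

Definition positive_string n : pred (n.-tuple nat) :=
  fun a => positive_digits a.

(* [0; s_1, ..., s_m] = 1 / (s_1 + 1 / (s_2 + ... + 1 / s_m)), and [0; ] = 0 *)
Definition cf_value (R : realType) (s : seq nat) : R :=
  foldr (fun a t => (a%:R + t)^-1) 0 s.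

Inductive cf_digits :=
  | FiniteCF of seq nat
  | InfiniteCF of (nat -> nat).

Definition digit (c : cf_digits) (i : nat) : option nat :=
  match c with
  | FiniteCF s => onth s i
  | InfiniteCF d => Some (d i)
  end.

(* The condition on the last digit is the normalization of the expansions of
   rational numbers; 0 has the empty expansion. Infinite expansions are the
   limits of their convergents. *)
Definition is_cf_expansion (R : realType) (x : R) (c : cf_digits) : Prop :=
  match c with
  | FiniteCF s =>
      [/\ positive_digits s, s != [::] -> (1 < last 0 s)%N
        & x = cf_value R s]
  | InfiniteCF d =>
      (forall i, (0 < d i)%N) /\
      (cf_value R (mkseq d m) @[m --> \oo] --> x)
  end.

(* I(a). A normalized expansion of x is unique, so this says that the i-th
   digit of x exists and equals a_i for i = 1, ..., n. *)
Definition cf_cylinder (R : realType) n (a : n.-tuple nat) : set R :=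
  [set x | 0 <= x < 1 /\
     exists2 c, is_cf_expansion x c &
       forall i : 'I_n, digit c i = Some (tnth a i)].

Definition P_GK (R : realType) n (a : n.-tuple nat) : R :=
  (ln 2)^-1 *
  \int[@lebesgue_measure R]_(x in cf_cylinder a) (1 + x)^-1.

Definition permute_string n (s : 'S_n) (a : n.-tuple nat) : n.-tuple nat :=
  [tuple tnth a (s i) | i < n].

Definition reverse_string n (a : n.-tuple nat) : n.-tuple nat :=
  [tuple of rev a].

Definition has_nontrivial_symmetry (R : realType) n (a : n.-tuple nat) : Prop :=
  exists s : 'S_n,
    [/\ permute_string s a <> a, permute_string s a <> reverse_string a
      & P_GK R (permute_string s a) = P_GK R a].

(* Main.v *)
(* Write q_n, p_n, q_(n-1), p_(n-1) for the continuants of a string a. The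
   cylinder I(a) is, up to its endpoints, the interval between p_n / q_n and
   (p_n + p_(n-1)) / (q_n + q_(n-1)); integrating 1 / (1 + x) over it and using
   q_n p_(n-1) - p_n q_(n-1) = (-1)^n gives
     P_GK a = (ln 2)^-1 |ln (D / (D - (-1)^n))|
   with D(a) = q_n (q_n + q_(n-1) + p_n + p_(n-1)) = K(a) K(1,a,1), where K is
   the continuant. So everything reduces to the integer D, which is invariant
   under reversal.
   (i) For (a,b,c) and (b,a,c) with a <> b, dividing the difference of the two
   values of D by b - a leaves an equation without positive solutions.
   (ii) For odd n, with w^r the reverse of w, the string (w,2,w^r) has
   D = 4 K(w) K(w,1) K(1,w) K(1,w,1), which is unchanged when w is replaced by
   w^r. For even n, strings f whose reverse multiplies the digits alternately
   by 2 and 1/2 satisfy a linear relation between their continuants, which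
   makes D(2,1,f') = D(1,f',2) where f' is f with its last digit increased
   by 1. *)

Require Import Defs.
From mathcomp Require Import all_boot all_order all_algebra all_fingroup.
From mathcomp Require Import all_classical all_reals all_analysis.
From mathcomp Require Import measurable_realfun.
From mathcomp Require Import ring lra zify.

Set Implicit Arguments.
Unset Strict Implicit.
Unset Printing Implicit Defensive.

Import Order.TTheory GRing.Theory Num.Theory.
Import numFieldNormedType.Exports.
Local Open Scope classical_set_scope.
Local Open Scope nat_scope.

(** * Continuants *)

(* The matrix product of the [[a_i,1],[1,0]] applied to u, so that
   cf_act a (1, 0) = (q_n, p_n) and cf_act a (0, 1) = (q_(n-1), p_(n-1)). *)
Definition cf_act (s : seq nat) (u : nat * nat) : nat * nat :=
  foldr (fun a v => (a * v.1 + v.2, v.1)) u s.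

Arguments cf_act s u%_N.

(** The number x M u, M being the matrix product of [cf_act]. At either end of the string, (1, 0)
    changes nothing, (0, 1) deletes a digit and (1, 1) adds a digit 1 before the continuant is
    taken. *)
Definition cf_form (x : nat * nat) (s : seq nat) (u : nat * nat) : nat :=
  x.1 * (cf_act s u).1 + x.2 * (cf_act s u).2.

Arguments cf_form x%_N s u%_N.

Lemma cf_form_cons x a s u :
  cf_form x (a :: s) u = cf_form (a * x.1 + x.2, x.1) s u.
Proof. by rewrite /cf_form /=; ring. Qed.

(** Naming the entries of M turns continuant identities into polynomial ones. *)
Lemma cf_form_bilinear s : exists A B C E : nat, forall x u,
  cf_form x s u = x.1 * (u.1 * A + u.2 * B) + x.2 * (u.1 * C + u.2 * E).
Proof.
elim: s => [|a s [A [B [C [E IH]]]]].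
  by exists 1, 0, 0, 1 => x u; rewrite /cf_form /=; ring.
exists (a * A + C), (a * B + E), A, B => x u.
by rewrite cf_form_cons IH /=; ring.
Qed.

Lemma cf_form_cat x s t u : cf_form x (s ++ t) u = cf_form x s (cf_act t u).
Proof. by rewrite /cf_form /cf_act foldr_cat. Qed.

(** The factors are symmetric matrices, so reversing the string transposes M. *)
Lemma cf_form_rev x s u : cf_form x (rev s) u = cf_form u s x.
Proof.
elim: s x u => [|a s IH] x u; first by rewrite /cf_form /=; ring.
by rewrite rev_cons -cats1 cf_form_cat IH cf_form_cons.
Qed.

Lemma cf_act_form s u : cf_act s u = (cf_form (1, 0) s u, cf_form (0, 1) s u).
Proof. by rewrite /cf_form !mul1n !mul0n addn0 add0n; case: cf_act. Qed.

(* K(a) K(1,a,1) *)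
Definition gk_den (s : seq nat) : nat :=
  cf_form (1, 0) s (1, 0) * cf_form (1, 1) s (1, 1).

(** The middle 2 splits both factors: K(w,2,w^r) = 2 K(w) K(w,1) and K(1,w,2,w^r,1) = 2 K(1,w)
    K(1,w,1). *)
Lemma gk_den_doubled w : gk_den (w ++ 2 :: rev w) = gk_den (rev w ++ 2 :: w).
Proof.
have [A [B [C [E H]]]] := cf_form_bilinear w.
rewrite /gk_den !cf_form_cat /= !(cf_act_form (rev w)) !(cf_act_form w).
by rewrite !cf_form_rev /= !H /=; ring.
Qed.

(* Reading the string backwards multiplies its digits alternately by 2 and 1/2
   (starting with 2 when b is true). *)
Fixpoint double_mirror (b : bool) (p : seq nat) : seq nat :=
  if p is x :: p' then
    (if b then x else 2 * x) :: double_mirror (~~ b) p' ++ [:: if b then 2 * x else x]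
  else [::].

(** Adding an outer pair of digits swaps the off-diagonal entries of M and adds to them multiples of
    its top left entry in the ratio 2 : 1; hence the alternation in [b]. *)
Lemma double_mirror_form b p :
  (if b then cf_form (0, 1) (double_mirror b p) (1, 0) =
             2 * cf_form (1, 0) (double_mirror b p) (0, 1)
   else cf_form (1, 0) (double_mirror b p) (0, 1) =
        2 * cf_form (0, 1) (double_mirror b p) (1, 0)).
Proof.
elim: p b => [|x p IH] b; first by case: b.
have [A [B [C [E H]]]] := cf_form_bilinear (double_mirror (~~ b) p).
have := IH (~~ b); case: b H => /= H; rewrite !cf_form_cons !cf_form_cat !H /=; lia.
Qed.

(** Let f- be f without its last digit, -f without its first, -f- without both. The increment of the
    last digit yields K(-f) = 2 K(f-) + K(-f-). Then K(1,2,1,f,1) = 2 K(1,f,2) and K(1,1,f,2,1) = 2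
    K(2,1,f), so both sides are 2 K(2,1,f) K(1,f,2). *)
Lemma gk_den_rot c p (f := c :: double_mirror false p ++ [:: (2 * c).+1]) :
  gk_den (2 :: 1 :: f) = gk_den (1 :: f ++ [:: 2]).
Proof.
have [A [B [C [E H]]]] := cf_form_bilinear (double_mirror false p).
have /= := double_mirror_form false p; rewrite !H /= => H'.
have {H'} HB : B = 2 * C by lia.
by rewrite /gk_den /f /= -!catA !cf_form_cons !cf_form_cat !H HB /= -addn1; ring.
Qed.

Lemma double_mirror_inj b p p' : size p = size p' ->
  double_mirror b p = double_mirror b p' -> p = p'.
Proof.
elim: p b p' => [|x p IH] b [|y p'] //= [sz] [Exy]; rewrite !cats1 => /rcons_inj[E _].
by rewrite (IH _ _ sz E); congr (_ :: _); case: b Exy {E} => //; lia.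
Qed.

Lemma size_double_mirror b p : size (double_mirror b p) = (size p).*2.
Proof. by elim: p b => //= x p IH b; rewrite size_cat /= IH addn1 doubleS. Qed.

Lemma double_mirror_positive b p :
  positive_digits p -> positive_digits (double_mirror b p).
Proof.
rewrite /positive_digits; elim: p b => //= x p IH b /andP[x_gt0 /(IH (~~ b)) pos].
by rewrite all_cat pos; case: b {pos} => /=; lia.
Qed.

(** * Strings of length three *)

Lemma gk_den3 a b c :
  gk_den [:: a; b; c] =
  (a * b * c + a + c) * (a * b * c + a * b + b * c + a + b + c + 2).
Proof. by rewrite /gk_den /cf_form /=; ring. Qed.

Lemma gk_den3_inj a b c : 0 < a -> 0 < b -> 0 < c ->
  gk_den [:: a; b; c] = gk_den [:: b; a; c] -> a = b.
Proof.
wlog le_ab : a b / a <= b.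
  by case: (leqP a b) => [|/ltnW] le W *; [|symmetry]; apply: W.
rewrite !gk_den3 => a_gt0 b_gt0 c_gt0.
have [d -> {b le_ab b_gt0}] : exists d, b = a + d by exists (b - a); lia.
case: d => [|d] D_eq; first by rewrite addn0.
set b := a + d.+1.
(* The difference of the two values of D, with the factor b - a exposed. *)
have /eqP : d.+1 * ((a * b * c + a + b + c) * c) =
            d.+1 * (a * b * c + a * b + b * c + a * c + a + b + c + 2).
  by rewrite /b; lia.
rewrite eqn_pmul2l // => /eqP {D_eq}.
have ab_lt : a < b by rewrite /b; lia.
(* For c = 1 the right side is larger, for c >= 3 the left one. For c = 2 the equation reads (a -
   1)(b - 1) = 1, which a < b excludes. *)
case: c c_gt0 => [|[|[|c]]] // _; move: b ab_lt => b ab_lt; [lia| |nia].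
by case: a a_gt0 ab_lt => [|[|a]] // _ ab_lt; nia.
Qed.

(** * Cylinders and their Gauss-Kuzmin measure *)

Local Open Scope ring_scope.

(** The inverse branch of the iterated Gauss map with digits [s]; at t = 0 it is [cf_value]. *)
Definition cf_tail (R : realType) (s : seq nat) (t : R) : R :=
  foldr (fun a t => (a%:R + t)^-1) t s.

Lemma digit_ge1 (R : realType) a s : positive_digits (a :: s) -> 1 <= a%:R :> R.
Proof. by case/andP=> a_gt0 _; rewrite ler1n. Qed.

Lemma cf_tail_ge0 (R : realType) s (t : R) :
  positive_digits s -> 0 <= t -> 0 <= cf_tail s t.
Proof.
elim: s => //= a s IH pos t_ge0; have /andP[_ /IH/(_ t_ge0)] := pos.
by rewrite invr_ge0; have := digit_ge1 R pos; lra.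
Qed.

Lemma cf_tail_itv (R : realType) s (t : R) :
  positive_digits s -> 0 < t < 1 -> 0 < cf_tail s t < 1.
Proof.
move=> + t_itv; elim: s => //= a s IH pos; have /andP[_ /IH] := pos.
have := digit_ge1 R pos => a_ge1 /andP[t_gt0 _].
by rewrite invr_gt0 invf_lt1; lra.
Qed.

Lemma cf_tail_le1 (R : realType) s (t : R) :
  positive_digits s -> 0 <= t <= 1 -> 0 <= cf_tail s t <= 1.
Proof.
case: s => //= a s pos /andP[t_ge0 _]; have /andP[_ pos'] := pos.
have := cf_tail_ge0 pos' t_ge0; have := digit_ge1 R pos => a_ge1.
rewrite -/(cf_tail s t) => y_ge0.
by rewrite invr_ge0 invf_le1; lra.
Qed.

Lemma cf_act_det (R : realType) s :
  (cf_act s (1, 0)).1%:R * (cf_act s (0, 1)).2%:R -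
  (cf_act s (1, 0)).2%:R * (cf_act s (0, 1)).1%:R = (-1) ^+ size s :> R.
Proof.
elim: s => [|a s IH] /=; first by rewrite mulr0 subr0 mulr1 expr0.
by rewrite exprS -IH !natrD !natrM; ring.
Qed.

Lemma cf_act_den_ge s : positive_digits s ->
  ((size s).+1 <= 2 * (cf_act s (1, 0)).1)%N.
Proof.
move=> pos; 
(* Strengthened for the induction: q(a,s) = a q(s) + p(s) grows by at least 1 once p(s) > 0. *)
suff: (0 < (cf_act s (1, 0)).1 /\ size s <= (cf_act s (1, 0)).1)%N /\
      (s != [::] -> 0 < (cf_act s (1, 0)).2)%N.
  by case=> [[q_gt0 q_ge] _]; apply: (leq_ltn_trans q_ge); rewrite ltn_Pmull.
elim: s pos => //= a s IH /andP[a_gt0 /IH[[q_gt0 q_ge] p_gt0]]; split; last by [].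
case: s p_gt0 q_gt0 q_ge {IH} => [|b s] /= p_gt0 q_gt0 q_ge; first by lia.
by have := p_gt0 isT; nia.
Qed.

Lemma cf_tailE (R : realType) s (t : R) : positive_digits s -> 0 <= t ->
  cf_tail s t = ((cf_act s (1, 0)).2%:R + t * (cf_act s (0, 1)).2%:R) /
                ((cf_act s (1, 0)).1%:R + t * (cf_act s (0, 1)).1%:R).
Proof.
move=> + t_ge0; elim: s => [|a s IH] pos /=; first by rewrite add0r mulr0 mulr1 addr0 divr1.
have /andP[_ pos'] := pos; rewrite -/(cf_tail s t) (IH pos').
have := cf_act_den_ge pos; have := cf_act_den_ge pos'.
rewrite -!/(cf_act _ _) /= !natrD !natrM.
move: (cf_act s (1, 0)) (cf_act s (0, 1)) => [q p] [q' p'] /= q_gt0 q_gt0'.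
have {}q_gt0 : 0 < q%:R + t * q'%:R :> R.
  by rewrite ltr_wpDr ?mulr_ge0// ltr0n; lia.
have {}q_gt0' : 0 < a%:R * q%:R + p%:R + t * (a%:R * q'%:R + p'%:R) :> R.
  rewrite ltr_wpDr ?mulr_ge0 ?addr_ge0 ?mulr_ge0//.
  by rewrite -natrM -natrD ltr0n; lia.
by field; rewrite ?gt_eqF //; move: q_gt0'; lra.
Qed.

(** By the determinant, the difference is t / (q_n (q_n + t q_(n-1))) up to sign, hence at most 1 /
    q_n. *)
Lemma cf_tail_value (R : realType) s (t : R) : positive_digits s -> 0 <= t <= 1 ->
  `|cf_tail s t - cf_value R s| <= 2 * (size s).+1%:R^-1.
Proof.
move=> pos /andP[t_ge0 t_le1]; rewrite -[cf_value R s]/(cf_tail s 0) !cf_tailE//.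
have := cf_act_den_ge pos; have := cf_act_det R s.
move: (cf_act s (1, 0)) (cf_act s (0, 1)) => [q p] [q' p'] /= det q_ge.
have q_ge1 : 1 <= q%:R :> R by rewrite ler1n; lia.
have q'_ge0 : 0 <= t * q'%:R by rewrite mulr_ge0.
have -> : (p%:R + t * p'%:R) / (q%:R + t * q'%:R) - (p%:R + 0 * p'%:R) / (q%:R + 0 * q'%:R) =
  t * (-1) ^+ size s / (q%:R * (q%:R + t * q'%:R)).
  by rewrite -det; field; rewrite ?gt_eqF //; lra.
have X_gt0 : 0 < q%:R * (q%:R + t * q'%:R) by rewrite mulr_gt0; lra.
rewrite normrM normrM normrX normrN1 expr1n mulr1 normfV (ger0_norm t_ge0).
rewrite (gtr0_norm X_gt0).
have le1 : q%:R^-1 <= 2 * (size s).+1%:R^-1 :> R.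
  rewrite -div1r ler_pdivrMr; last lra.
  rewrite mulrAC ler_pdivlMr ?ltr0n// mul1r -natrM ler_nat; exact: q_ge.
apply: le_trans le1; rewrite invfM mulrA ler_pdivrMr; last lra.
rewrite [leLHS]mulrC ler_pM2l ?invr_gt0; lra.
Qed.

Lemma cf_tail_rcons (R : realType) s a (t : R) :
  cf_tail (rcons s a) t = cf_tail s (a%:R + t)^-1.
Proof. exact: foldr_rcons. Qed.

Lemma cf_tail_cat (R : realType) s1 s2 (t : R) :
  cf_tail (s1 ++ s2) t = cf_tail s1 (cf_tail s2 t).
Proof. exact: foldr_cat. Qed.

(** * The Gauss map and existence of expansions *)

Definition gauss_digit (R : realType) (x : R) : nat := Num.truncn x^-1.

Definition gauss_map (R : realType) (x : R) : R := x^-1 - (gauss_digit x)%:R.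

Lemma gauss_map_cf_tail (R : realType) a s (t : R) :
  positive_digits s -> 0 < t < 1 ->
  gauss_digit (cf_tail (a :: s) t) = a /\ gauss_map (cf_tail (a :: s) t) = cf_tail s t.
Proof.
move=> pos t_itv; have /andP[y_gt0 y_lt1] := cf_tail_itv pos t_itv.
suff E : gauss_digit (cf_tail (a :: s) t) = a.
  by split=> //; rewrite /gauss_map E /= invrK -/(cf_tail s t) addrC addKr.
by apply: truncn_def; rewrite /= invrK -/(cf_tail s t) -natr1; lra.
Qed.

Lemma gauss_itv (R : realType) (x : R) : 0 < x < 1 ->
  [/\ (0 < gauss_digit x)%N, 0 <= gauss_map x < 1
    & x = ((gauss_digit x)%:R + gauss_map x)^-1].
Proof.
move=> /andP[x_gt0 x_lt1].
have inv_gt1 : 1 < x^-1 by rewrite invf_gt1.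
have /andP[le_d lt_d] := truncn_itv (ltW (lt_trans ltr01 inv_gt1)).
split; last by rewrite /gauss_map addrC subrK invrK.
  rewrite lt0n; apply: contraTneq lt_d; rewrite /gauss_digit => ->; lra.
by rewrite /gauss_map /gauss_digit; move: lt_d; rewrite -natr1; lra.
Qed.

Definition gauss_digits (R : realType) (x : R) (i : nat) : nat :=
  gauss_digit (iter i (@gauss_map R) x).

Lemma gauss_orbit (R : realType) (x : R) k : 0 < x < 1 ->
  (forall i, (i < k)%N -> iter i (@gauss_map R) x != 0) ->
  [/\ positive_digits (mkseq (gauss_digits x) k),
      0 <= iter k (@gauss_map R) x < 1
    & x = cf_tail (mkseq (gauss_digits x) k) (iter k (@gauss_map R) x)].
Proof.
move=> x_itv; elim: k => [|k IH] orbit_neq0; first by split=> //=; lra.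
have [|pos xk_itv xE] := IH; first by move=> i /ltnW; apply: orbit_neq0.
have xk_neq0 := orbit_neq0 k (ltnSn k).
have [|d_gt0 itv xkE] := @gauss_itv _ (iter k (@gauss_map R) x).
  by rewrite lt_def xk_neq0.
rewrite mkseqS; split => //.
  by rewrite /positive_digits all_rcons d_gt0; exact: pos.
by rewrite cf_tail_rcons -xkE.
Qed.

(* The expansion is finite exactly when the orbit of x under the Gauss map
   reaches 0. *)
Lemma gauss_expansion (R : realType) (x : R) : 0 < x < 1 ->
  exists2 c, is_cf_expansion x c &
    forall n, (forall i, (i < n)%N -> iter i (@gauss_map R) x != 0) ->
      forall i, (i < n)%N -> digit c i = Some (gauss_digits x i).
Proof.
move=> x_itv; have [reach0|never] := pselect (exists k, iter k (@gauss_map R) x == 0).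
  have [k xk0 k_min] := ex_minnP reach0.
  have orbit_neq0 i : (i < k)%N -> iter i (@gauss_map R) x != 0.
    by move=> ik; apply: contraL ik; rewrite -leqNgt => /k_min.
  have [pos _ xE] := gauss_orbit x_itv orbit_neq0.
  exists (FiniteCF (mkseq (gauss_digits x) k)) => /=.
    split => //; last by rewrite [LHS]xE (eqP xk0).
    case: k xk0 {k_min pos xE} orbit_neq0 => // k xk0 orbit_neq0 _.
    rewrite mkseqS last_rcons /gauss_digits.
    have [|_ /andP[xk_ge0 xk_lt1] _] := @gauss_orbit _ x k x_itv.
      by move=> i /ltnW; apply: orbit_neq0.
    have xk_neq0 := orbit_neq0 k (ltnSn k).
    have xk_gt0 : 0 < iter k (@gauss_map R) x by rewrite lt_def xk_neq0.
    (* The next iterate is 0, so the last digit is the inverse of a point of (0,1) and exceeds 1. *)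
    rewrite -(ltr1n R); move: xk0; rewrite iterS /gauss_map subr_eq0 => /eqP <-.
    by rewrite invf_gt1.
  move=> n n_neq0 i lt_in.
  have lt_ik : (i < k)%N.
    rewrite ltnNge; apply: contraL xk0 => le_ki.
    by apply: n_neq0; exact: leq_ltn_trans lt_in.
  by rewrite /= onthE (nth_map 0%N) ?size_mkseq ?nth_mkseq.
have orbit_neq0 k i : (i < k)%N -> iter i (@gauss_map R) x != 0.
  by move=> _; apply/negP => xi0; apply: never; exists i.
exists (InfiniteCF (gauss_digits x)) => //; split.
  move=> i; have [+ _ _] := gauss_orbit x_itv (orbit_neq0 i.+1).
  by rewrite mkseqS /positive_digits all_rcons => /andP[].
apply/cvgrPdist_le => e e_gt0.
have : 2 * @harmonic R m @[m --> \oo] --> (0 : R).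
  rewrite -[X in _ --> X](mulr0 2); apply: cvgM; [exact: cvg_cst|exact: cvg_harmonic].
move=> /cvgrPdist_le/(_ e e_gt0); apply: filterS => m.
rewrite /= sub0r normrN ger0_norm ?mulr_ge0// => le_e; apply: le_trans le_e.
have [pos /andP[? ?] xE] := gauss_orbit x_itv (orbit_neq0 m).
rewrite {1}xE; apply: le_trans (cf_tail_value pos _) _; first by lra.
by rewrite size_mkseq.
Qed.

(** * Cylinders as intervals *)

Definition between_onto (R : realType) (g : R -> R) (u v : R) : Prop :=
  [/\ u < v, forall t, 0 <= t <= 1 -> u <= g t <= v
    & forall x, u < x < v -> exists2 t, 0 < t < 1 & x = g t].

(** Each digit contributes an order-reversing map, so the two endpoints trade places at every step
    of the induction. *)
Lemma cf_tail_between (R : realType) s : positive_digits s ->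
  between_onto (@cf_tail R s) (cf_tail s 0) (cf_tail s 1) \/
  between_onto (@cf_tail R s) (cf_tail s 1) (cf_tail s 0).
Proof.
have step (a : nat) (g : R -> R) u v : (0 < a)%N -> 0 <= u -> between_onto g u v ->
    between_onto (fun t => (a%:R + g t)^-1) (a%:R + v)^-1 (a%:R + u)^-1.
  rewrite -(ler1n R) => a_ge1 u_ge0 [uv g_itv g_onto].
  split=> [|t /g_itv/andP[ut tv]|x /andP[vx xu]].
  - by rewrite ltf_pV2 ?posrE; lra.
  - by rewrite !lef_pV2 ?posrE; lra.
  - have x_gt0 : 0 < x by rewrite (lt_trans _ vx)// invr_gt0; lra.
    have [|t t_itv xt] := g_onto (x^-1 - a%:R).
      rewrite ltrBrDl ltrBlDl -[a%:R + u]invrK -[a%:R + v]invrK.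
      by rewrite !ltf_pV2 ?posrE ?vx ?xu // invr_gt0; lra.
    by exists t => //; rewrite -xt addrC subrK invrK.
elim: s => [_|a s IH /andP[a_gt0 pos]].
  by left; split=> //= x x_itv; exists x.
have g0 := cf_tail_ge0 pos (lexx 0); have g1 := cf_tail_ge0 pos (@ler01 R).
by case: (IH pos) => [/step|/step] H; [right|left]; apply: H.
Qed.

(** [A] is known only up to endpoints; its integral is squeezed between those over the open and the
    closed interval, which agree. *)
Lemma integral_inv_ln (R : realType) (u v : R) (A : set R) : 0 <= u -> u < v ->
  `]u, v[ `<=` A -> A `<=` `[u, v] ->
  \int[@lebesgue_measure R]_(x in A) (1 + x)^-1 = ln (1 + v) - ln (1 + u).
Proof.
move=> u_ge0 uv sub_oo sub_cc.
have mA : measurable A.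
  have -> : A = `]u, v[ `|` (A `&` [set u; v]).
    apply/seteqP; split=> [x Ax|x [/sub_oo//|[]//]].
    have := sub_cc _ Ax; rewrite /= in_itv /= => /andP[ux xv].
    have [xu|xu] := eqVneq x u; first by right; split=> //; left.
    have [xv'|xv'] := eqVneq x v; first by right; split=> //; right.
    by left; rewrite in_itv /= !lt_def xu ux xv eq_sym xv'.
  apply: measurableU => //; apply: countable_measurable; first by move=> t; apply: measurable_set1.
  by apply: finite_set_countable; apply: finite_setIr; exact: finite_set2.
have is_der (x : R) : 0 <= x -> is_derive x 1 (fun y : R => ln (1 + y)) (1 + x)^-1.
  move=> x_ge0; rewrite -[(1 + x)^-1]mulr1.
  apply: (@is_derive1_comp _ (@ln R) (fun y => 1 + y)).
    by apply: is_derive1_ln; lra.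
  rewrite -[X in is_derive _ _ _ X]add0r.
  exact: (is_deriveD (is_derive_cst (1 : R) x 1) (is_derive_id x (1 : R))).
have f_cont : {within `[u, v], continuous (fun x : R => (1 + x)^-1)}.
  apply: continuous_in_subspaceT => x; rewrite inE /= in_itv /= => /andP[ux _].
  apply: cvgV; first by rewrite gt_eqF//; lra.
  by apply: cvgD; [exact: cvg_cst|exact: cvg_id].
have f_meas : measurable_fun `[u, v] (EFin \o (fun x : R => (1 + x)^-1)).
  by apply/measurable_EFinP; apply: subspace_continuous_measurable_fun.
have f_ge0 (x : R) : `[u, v]%classic x -> (0 <= ((1 + x)^-1)%:E)%E.
  by rewrite /= in_itv /= => /andP[ux _]; rewrite lee_fin invr_ge0; lra.
have F_cont (x : R) : 0 <= x -> ln (1 + y) @[y --> x] --> ln (1 + x).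
  move=> x_ge0; have [+ _] := is_der x x_ge0.
  by move=> /derivable1_diffP/differentiable_continuous.
have FTC := @continuous_FTC2 R (fun x => (1 + x)^-1) (fun x => ln (1 + x)) u v uv f_cont.
have {FTC}cc : (\int[@lebesgue_measure R]_(x in `[u, v]) ((1 + x)^-1)%:E = (ln (1 + v) - ln (1 + u))%:E)%E.
  apply: FTC.
    split=> [x|| ].
    - by rewrite in_itv /= => /andP[ux _]; have [] := is_der x _; first lra.
    - by apply: cvg_at_right_filter; exact: F_cont.
    - by apply: cvg_at_left_filter; apply: F_cont; lra.
  move=> x; rewrite in_itv /= => /andP[ux _].
  by rewrite derive1E; apply: derive_val; apply: is_der; lra.
rewrite /Rintegral; suff -> : (\int[@lebesgue_measure R]_(x in A) ((1 + x)^-1)%:E = (ln (1 + v) - ln (1 + u))%:E)%E by [].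
rewrite -cc; apply/eqP; rewrite eq_le; apply/andP; split.
  exact: ge0_subset_integral.
rewrite (@integral_itv_bndoo _ u v _ true false).
  apply: ge0_subset_integral => //.
  - exact: measurable_funS f_meas.
  - by move=> x /sub_cc; exact: f_ge0.
by apply: measurable_funS f_meas => //; apply: subset_itv_oo_cc.
Qed.

Lemma onth_prefix (T : Type) (x0 : T) (s a : seq T) :
  (forall i, (i < size a)%N -> onth s i = Some (nth x0 a i)) ->
  s = a ++ drop (size a) s.
Proof.
elim: a s => [|x a IH] [|y s] //= H; first by have := H 0 isT.
have [->] := H 0 isT; congr (_ :: _); apply: IH => i lt_i.
exact: (H i.+1).
Qed.

Lemma iter_gauss_cf_tail (R : realType) s (t : R) i :
  positive_digits s -> 0 < t < 1 -> (i <= size s)%N ->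
  iter i (@gauss_map R) (cf_tail s t) = cf_tail (drop i s) t.
Proof.
move=> pos t_itv; elim: i => [|i IH] lt_is; first by rewrite drop0.
have pos' : positive_digits (drop i.+1 s).
  by apply/allP => b /mem_drop/(allP pos).
rewrite iterS IH ?(ltnW lt_is)// (drop_nth 0%N lt_is).
by have [] := gauss_map_cf_tail (nth 0%N s i) pos' t_itv.
Qed.

(** An interior point has Gauss digits starting with [a]. Conversely, an expansion starting with [a]
    has its value, or all its convergents of length at least n, in the closed interval, which
    contains limits. *)
Lemma cf_cylinder_itv (R : realType) n (a : n.-tuple nat) (u v : R) :
  positive_string a -> between_onto (@cf_tail R a) u v ->
  `]u, v[ `<=` cf_cylinder a /\ @cf_cylinder R n a `<=` `[u, v].
Proof.
move=> pos [uv a_itv a_onto]; split=> [x|x [_ [c cx dig]]].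
  rewrite /= in_itv /= => /a_onto[t t_itv xE].
  have x_itv : 0 < x < 1 by rewrite xE cf_tail_itv.
  have orbitE i : (i <= n)%N -> iter i (@gauss_map R) x = cf_tail (drop i a) t.
    by move=> le_in; rewrite xE iter_gauss_cf_tail ?size_tuple.
  split; first by lra.
  have [c cx dig] := gauss_expansion x_itv; exists c => // i.
  rewrite (dig n) // => [|j lt_jn].
    congr Some; rewrite /gauss_digits orbitE; last exact/ltnW.
    rewrite (drop_nth 0%N) ?size_tuple// (tnth_nth 0%N).
    have pos' : positive_digits (drop i.+1 a).
      by apply/allP => b /mem_drop/(allP pos).
    by have [] := gauss_map_cf_tail (nth 0%N a i) pos' t_itv.
  rewrite orbitE ?(ltnW lt_jn)// gt_eqF//.
  have pos' : positive_digits (drop j a).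
    by apply/allP => b /mem_drop/(allP pos).
  by have /andP[] := cf_tail_itv pos' t_itv.
have prefix_itv s : positive_digits s ->
    (forall i, (i < n)%N -> onth s i = Some (nth 0%N a i)) -> u <= cf_value R s <= v.
  move=> pos_s pre; rewrite (@onth_prefix _ 0%N s a); last by rewrite size_tuple.
  rewrite -[cf_value _ _]/(cf_tail _ 0) cf_tail_cat; apply: a_itv.
  apply: cf_tail_le1; last by rewrite lexx ler01.
  by apply/allP => b /mem_drop/(allP pos_s).
have {}dig i : (i < n)%N -> digit c i = Some (nth 0%N a i).
  by move=> lt_in; have := dig (Ordinal lt_in); rewrite (tnth_nth 0%N).
rewrite /= in_itv /=; case: c cx dig => [s [pos_s _ ->] pre|d [d_gt0 x_lim] dig].
  exact: prefix_itv.
have : `[u, v]%classic x; last by rewrite /= in_itv.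
apply: (closed_cvg _ (@itv_closed _ _ u v) _ _ x_lim).
exists n => // m le_nm; rewrite /= in_itv; apply: prefix_itv.
  by apply/allP => b /mapP[i _ ->].
move=> i lt_in; have lt_im := leq_trans lt_in le_nm.
by rewrite onthE (nth_map 0%N) ?size_mkseq// nth_mkseq//; apply: dig.
Qed.

(** * The measure of a cylinder *)

Lemma gk_denE s : let q := (cf_act s (1, 0)).1 in let p := (cf_act s (1, 0)).2 in
  let q' := (cf_act s (0, 1)).1 in let p' := (cf_act s (0, 1)).2 in
  gk_den s = (q * (q + q' + (p + p')))%N.
Proof.
have [A [B [C [E H]]]] := cf_form_bilinear s.
by rewrite /gk_den !cf_act_form !H /=; ring.
Qed.

Lemma P_GK_gk_den (R : realType) n (a : n.-tuple nat) : positive_string a ->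
  0 < (gk_den a)%:R - (-1) ^+ n :> R /\
  P_GK R a = (ln 2)^-1 * `|ln ((gk_den a)%:R / ((gk_den a)%:R - (-1) ^+ n))|.
Proof.
move=> pos; rewrite /P_GK.
have cylE u v : 0 <= u -> between_onto (@cf_tail R a) u v ->
    \int[@lebesgue_measure R]_(x in cf_cylinder a) (1 + x)^-1 = ln (1 + v) - ln (1 + u).
  move=> u_ge0 bet; have [? ?] := cf_cylinder_itv pos bet.
  by apply: integral_inv_ln => //; case: bet.
have u_ge0 := cf_tail_ge0 pos (lexx (0 : R)).
have v_ge0 := cf_tail_ge0 pos (@ler01 R).
(* The absolute value covers both orders of the endpoints. *)
have -> : \int[@lebesgue_measure R]_(x in cf_cylinder a) (1 + x)^-1 =
    `|ln ((1 + cf_tail a 1) / (1 + cf_tail a 0))|.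
  rewrite ln_div ?posrE; [|lra|lra].
  case: (cf_tail_between R pos) => bet; rewrite (cylE _ _ _ bet) //; have [uv _ _] := bet.
    by rewrite ger0_norm// subr_ge0 ler_ln ?posrE; lra.
  by rewrite distrC ger0_norm// subr_ge0 ler_ln ?posrE; lra.
rewrite !cf_tailE// gk_denE.
have := cf_act_den_ge pos; have := cf_act_det R a; rewrite size_tuple => <-.
move: (cf_act a (1, 0)) (cf_act a (0, 1)) => [q p] [q' p'] /= q_ge.
have {}q_ge : 1 <= q%:R :> R by rewrite ler1n; lia.
have [p_ge0 q'_ge0 p'_ge0] : [/\ 0 <= p%:R :> R, 0 <= q'%:R :> R & 0 <= p'%:R :> R] by [].
rewrite !natrM !natrD.
move: q%:R p%:R q'%:R p'%:R q_ge p_ge0 q'_ge0 p'_ge0 => {}q {}p {}q' {}p' q_ge p_ge0 q'_ge0 p'_ge0.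
(* With (-1)^n written as the determinant, D - (-1)^n factors into the denominator of the ratio
   inside the logarithm. *)
have -> : q * (q + q' + (p + p')) - (q * p' - p * q') = (q + p) * (q + q') by ring.
have X_gt0 : 0 < (q + p) * (q + q') by rewrite mulr_gt0; lra.
split=> //; congr (_ * `|ln _|).
by field; rewrite !gt_eqF//; lra.
Qed.

(** * Symmetries *)

Lemma P_GK_eq (R : realType) n (a b : n.-tuple nat) :
  positive_string a -> positive_string b -> gk_den a = gk_den b ->
  P_GK R a = P_GK R b.
Proof.
by move=> /(P_GK_gk_den R)[_ ->] /(P_GK_gk_den R)[_ ->] ->.
Qed.

Lemma gk_den_gt0 s : positive_digits s -> (0 < gk_den s)%N.
Proof.
move=> /cf_act_den_ge; rewrite gk_denE muln_gt0.
by move: (cf_act s (1, 0)).1 => q q_ge; apply/andP; split; lia.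
Qed.

(** For odd n the ratio is D / (D + 1) < 1: the logarithm has a fixed sign, and the ratio determines
    D. *)
Lemma P_GK_odd_inj (R : realType) n (a b : n.-tuple nat) : odd n ->
  positive_string a -> positive_string b -> P_GK R a = P_GK R b ->
  gk_den a = gk_den b.
Proof.
move=> n_odd pos_a pos_b.
have [_ ->] := P_GK_gk_den R pos_a; have [_ ->] := P_GK_gk_den R pos_b.
have ln2_gt0 : 0 < ln 2 :> R by rewrite ln_gt0 // ltr1n.
move/(mulfI (invr_neq0 (lt0r_neq0 ln2_gt0))).
rewrite -signr_odd n_odd expr1 opprK.
have ratio_itv (D : nat) : (0 < D)%N -> 0 < (D%:R / (D%:R + 1) : R) < 1.
  rewrite -(ltr0n R) => D_gt0.
  by rewrite divr_gt0 ?ltr_pdivrMr; lra.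
have A_itv := ratio_itv _ (gk_den_gt0 pos_a).
have B_itv := ratio_itv _ (gk_den_gt0 pos_b).
have := gk_den_gt0 pos_a; have := gk_den_gt0 pos_b; rewrite -!(ltr0n R) => b_gt0 a_gt0.
rewrite !ltr0_norm ?ln_lt0// => /oppr_inj/ln_inj; rewrite !posrE.
case/andP: A_itv => -> _; case/andP: B_itv => -> _ => /(_ isT isT) /eqP.
have a_neq0 : (gk_den a)%:R + 1 != 0 :> R by rewrite gt_eqF//; lra.
have b_neq0 : (gk_den b)%:R + 1 != 0 :> R by rewrite gt_eqF//; lra.
rewrite eqr_div// => /eqP E.
by apply/eqP; rewrite -(eqr_nat R); apply/eqP; lra.
Qed.

Lemma permute_string_positive n (s : 'S_n) (a : n.-tuple nat) :
  positive_string a -> positive_string (permute_string s a).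
Proof.
by move=> /allP pos; apply/allP => b /mapP[i _ ->]; apply: pos; apply: mem_tnth.
Qed.

Lemma nontrivial_symmetryP (R : realType) n (a : n.-tuple nat) (b : seq nat) :
  positive_string a -> perm_eq b a -> b <> a -> b <> rev a ->
  gk_den b = gk_den a -> has_nontrivial_symmetry R a.
Proof.
move=> pos /tuple_permP[s ->] neq_a neq_rev den_eq; exists s; split.
- by move=> E; apply: neq_a; rewrite -[in RHS]E.
- by move=> /(congr1 val).
- by apply: P_GK_eq => //; apply: permute_string_positive.
Qed.

Lemma no_symmetry3 (R : realType) (a : 3.-tuple nat) :
  positive_string a -> ~ has_nontrivial_symmetry R a.
Proof.
move=> pos [s [neq_a neq_rev /esym]].
move=> P_eq; have := P_GK_odd_inj (isT : odd 3) pos (permute_string_positive s pos) P_eq.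
move=> {P_eq}.
have {}neq_a : permute_string s a <> a :> seq nat by move=> /val_inj.
have {}neq_rev : permute_string s a <> rev a :> seq nat
  by move=> E; apply/neq_rev/val_inj.
pose i1 : 'I_3 := lift ord0 ord0; pose i2 : 'I_3 := lift ord0 (lift ord0 ord0).
have sE : permute_string s a =
    [:: nth 0%N a (s ord0); nth 0%N a (s i1); nth 0%N a (s i2)] :> seq nat.
  by rewrite /= !enum_ordSl /= enum_ord0 /= !(tnth_nth 0%N).
rewrite sE in neq_a neq_rev *.
have s01 : s ord0 != s i1 :> nat by rewrite (inj_eq val_inj) (inj_eq perm_inj).
have s02 : s ord0 != s i2 :> nat by rewrite (inj_eq val_inj) (inj_eq perm_inj).
have s12 : s i1 != s i2 :> nat by rewrite (inj_eq val_inj) (inj_eq perm_inj).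
have rev_den x y z : gk_den [:: x; y; z] = gk_den [:: z; y; x].
  by rewrite !gk_den3; ring.
case: a pos {sE} neq_a neq_rev => -[|x [|y [|z []]]]// ? /and4P[x_gt0 y_gt0 z_gt0 _].
have inj_xy := gk_den3_inj x_gt0 y_gt0 z_gt0.
have inj_zy := gk_den3_inj z_gt0 y_gt0 x_gt0.
(* Identity and reversal are excluded by hypothesis. In the other four orders an end digit becomes
   the middle one; up to reversal this swaps the middle digit with an end digit, and equal D forces
   these two to agree. *)
case: (s ord0) (s i1) (s i2) s01 s02 s12
  => -[|[|[|]]]// ? [[|[|[|]]]// ?] [[|[|[|]]]// ?] //= _ _ _ neq_a neq_rev den_eq.
- by case: neq_a; rewrite inj_zy // (rev_den z) den_eq (rev_den x).
- by case: neq_a; rewrite (inj_xy den_eq).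
- by case: neq_rev; rewrite inj_zy // (rev_den z) den_eq.
- by case: neq_rev; rewrite inj_xy // den_eq rev_den.
Qed.

(* The last digit of w exceeds the first one, so w is not a palindrome. *)
Lemma mirrored_symmetry (R : realType) n (p : seq nat)
    (w := rcons p (sumn p).+1) (a : n.-tuple nat) :
  p != [::] -> positive_digits p -> val a = w ++ 2%N :: rev w ->
  positive_string a /\ has_nontrivial_symmetry R a.
Proof.
move=> p_neq0 pos aE.
have pos_a : positive_string a.
  by rewrite /positive_string /positive_digits aE all_cat /= all_rev all_rcons [all _ p]pos.
split=> //; apply: (@nontrivial_symmetryP _ _ _ (rev w ++ 2%N :: w)) => //; rewrite aE.
- by rewrite perm_catC perm_sym -(cat1s _ (rev w)) perm_catCA.
- move=> /eqP; rewrite eqseq_cat ?size_rev// /w rev_rcons => /andP[/eqP].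
  case: p p_neq0 {pos aE w} => //= x p _ [E] _; lia.
(* [a] is a palindrome, so this is the previous condition again. *)
- rewrite rev_cat rev_cons revK cat_rcons => /eqP.
  rewrite eqseq_cat ?size_rev// /w rev_rcons => /andP[/eqP].
  case: p p_neq0 {pos aE w} => //= x p _ [E] _; lia.
- by rewrite gk_den_doubled.
Qed.

(** The symmetry moves the leading 2 to the end. The new string starts with 1, while [a] starts with
    2 and its reverse with 2c + 1 > 1. *)
Lemma double_mirror_symmetry (R : realType) n c p (a : n.-tuple nat) :
  (0 < c)%N -> positive_digits p ->
  val a = [:: 2%N, 1%N, c & double_mirror false p ++ [:: (2 * c).+1]] ->
  positive_string a /\ has_nontrivial_symmetry R a.
Proof.
move=> c_gt0 pos aE.
have pos_a : positive_string a.
  rewrite /positive_string /positive_digits aE /= c_gt0 all_cat /= andbT.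
  exact: double_mirror_positive.
split=> //; apply: (@nontrivial_symmetryP _ _ _
  (1%N :: (c :: double_mirror false p ++ [:: (2 * c).+1]) ++ [:: 2%N])) => //; rewrite aE.
- by rewrite -[X in perm_eq X _]cat_cons perm_catC.
- by [].
- by rewrite -[_ :: _ :: _ :: _]/([:: 2%N; 1%N; c] ++ _ ++ _) !rev_cat /= => -[]; lia.
- by rewrite gk_den_rot.
Qed.

Local Close Scope ring_scope.

Theorem theorem3 (R : realType) :
  (~ exists a : 3.-tuple nat,
       positive_string a /\ has_nontrivial_symmetry R a) /\
  (forall n : nat, (4 <= n)%N ->
     exists F : ((n - 2) %/ 2).-tuple nat -> n.-tuple nat,
       {in @positive_string ((n - 2) %/ 2) &, injective F} /\
       (forall p : ((n - 2) %/ 2).-tuple nat, positive_string p ->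
          positive_string (F p) /\ has_nontrivial_symmetry R (F p))).
Proof.
split=> [[a [pos]]|n n_ge4]; first exact: no_symmetry3.
set m := ((n - 2) %/ 2)%N.
have m_gt0 : (0 < m)%N by rewrite /m; lia.
have p_neq0 (p : m.-tuple nat) : val p != [::] by rewrite -size_eq0 size_tuple; lia.
have [n_odd|n_even] := boolP (odd n).
  (* Here n = 2m + 3, and w consists of the m parameters and one extra digit. *)
  pose f (p : seq nat) := rcons p (sumn p).+1 ++ 2%N :: rev (rcons p (sumn p).+1).
  have f_size (p : m.-tuple nat) : size (f p) == n.
    by rewrite size_cat /= size_rev size_rcons size_tuple /m; lia.
  exists (fun p => Tuple (f_size p)); split=> [p q _ _ /(congr1 val)/eqP|p pos].
    rewrite /= eqseq_cat ?size_rcons ?size_tuple// => /andP[/eqP/rcons_inj[pq _] _].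
    exact: val_inj.
  exact: (mirrored_symmetry R (p_neq0 p) pos).
(* Here n = 2m + 2: the first parameter is c, the other m - 1 are doubled. As m > 0, the default of
   [head] never occurs. *)
pose f (p : seq nat) :=
  [:: 2%N, 1%N, head 0%N p & double_mirror false (behead p) ++ [:: (2 * head 0%N p).+1]].
have f_size (p : m.-tuple nat) : size (f p) == n.
  rewrite /= size_cat size_double_mirror size_behead size_tuple /= /m; lia.
exists (fun p => Tuple (f_size p)); split=> [p q _ _ /(congr1 val)|p pos].
  move=> [hd]; rewrite !cats1 => /rcons_inj[tl _]; apply: val_inj.
  case: p q {f_size} hd tl => -[|x p] szp [[|y q] szq] //= => [||-> tl].
  1,2: by have := eqP szp; have := eqP szq; rewrite /=; lia.
  congr (_ :: _); apply: double_mirror_inj tl.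
  by have := eqP szp; have := eqP szq; rewrite /=; lia.
case: p pos f_size => -[|x p] szp pos f_size.
  by have := eqP szp; rewrite /=; lia.
case/andP: pos => x_gt0 pos.
exact: (double_mirror_symmetry R x_gt0 pos).
Qed.
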